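(* Let $r\geqslant 3$ be an odd integer and let $M=2\mathbb N-1$ be the set of positive odd integers. Then for every $n\geqslant 0$, $$q_r(\mathbb N;n)\equiv q(M\setminus rM;n)\pmod 2.$$
   Context: $\mathbb N$ is the set of positive integers and $rM=\{rm: m\in M\}$. For a set $S$ of positive integers and $k\geqslant 2$, $q_k(S;n)$ is the number of partitions of $n$ with parts in $S$ in which each part occurs at most $k-1$ times, and $q(S;n)=q_2(S;n)$ is the number of partitions of $n$ into distinct parts from $S$. *)

(* Defs.v *)
From mathcomp Require Import all_boot.
From mathcomp Require Import boolp classical_sets.

Set Implicit Arguments.
Unset Strict Implicit.
Unset Printing Implicit Defensive.

Local Open Scope nat_scope.
Local Open Scope classical_set_scope.

Definition is_partition (n : nat) (s : seq nat) : bool :=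
  [&& sorted geq s, all (leq 1) s & sumn s == n].

Definition parts_in (S : set nat) (s : seq nat) : bool :=
  all (fun x => x \in S) s.

Definition mult_at_most (b : nat) (s : seq nat) : bool :=
  all (fun x => count_mem x s <= b) s.

(* A partition of n has at most n parts, each at most n, so the finite type    *)
(* n.-bseq 'I_n.+1 contains all of them; see partition_bseq.                   *)
Definition qk (k : nat) (S : set nat) (n : nat) : nat :=
  #|[pred t : n.-bseq 'I_n.+1 | let s := map val t in
      [&& is_partition n s, parts_in S s & mult_at_most (k - 1) s]]|.

Definition q (S : set nat) (n : nat) : nat := qk 2 S n.

Definition pos_nats : set nat := [set m | 0 < m].

Definition odd_nats : set nat := [set m | odd m].

Definition dilate (r : nat) (M : set nat) : set nat := [set r * m | m in M].

Lemma partition_bseq (n : nat) (s : seq nat) :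
  is_partition n s -> exists t : n.-bseq 'I_n.+1, map val t = s.
Proof.
move=> /and3P[_ s_gt0 /eqP s_sum].
have sz_s : size s <= n.
  rewrite -s_sum; elim: s s_gt0 {s_sum} => //= x s IHs /andP[x_gt0 /IHs].
  by move=> le_s; rewrite -add1n leq_add.
have s_le : all (fun x => x < n.+1) s.
  apply/allP => x; rewrite ltnS -s_sum => {s_gt0 s_sum sz_s}.
  elim: s => //= y s IHs; rewrite inE => /predU1P[->|/IHs le_x].
    exact: leq_addr.
  exact: leq_trans le_x (leq_addl _ _).
have eq_s : map val (map (@inord n) s) = s.
  rewrite -map_comp -[RHS]map_id; apply/eq_in_map => x /(allP s_le) /= lt_x.
  by rewrite inordK.
have sz_t : size (map (@inord n) s) <= n by rewrite size_map.
by exists (Bseq sz_t).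
Qed.

(* Main.v *)
(** Let D(x) be the product of the 1 + x^m over all m >= 1 and O(x) the product
    over odd m. Splitting m by parity, D(x) = O(x) D(x^2), and modulo 2 this is
    O(x) D(x)^2; hence O(x) D(x) = 1 modulo 2. The generating function of the
    left-hand side is D(x^r) / D(x) modulo 2, that is O(x) / O(x^r), which is
    the generating function of the right-hand side. All these identities
    are read in F_2[x] modulo x^(n+1). *)
Require Import Defs.
From mathcomp Require Import all_boot all_algebra.
From mathcomp Require Import boolp classical_sets.

Set Implicit Arguments.
Unset Strict Implicit.
Unset Printing Implicit Defensive.

Local Open Scope nat_scope.
Local Open Scope classical_set_scope.

(** * Partitions as multiplicity functions *)

Lemma sumn_count n s : all (ltn^~ n) s ->
  sumn s = \sum_(i < n) count_mem (val i) s * i.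
Proof.
elim: s => [|x s IHs] /=; first by rewrite big1.
case/andP=> x_lt /IHs ->; under [RHS]eq_bigr do rewrite mulnDl.
rewrite big_split /=; congr (_ + _).
rewrite (bigD1 (Ordinal x_lt)) //= eqxx mul1n big1 ?addn0 // => i.
by rewrite -val_eqE /= eq_sym => /negbTE->.
Qed.

Section Multiplicities.

Variables (k n : nat) (S : set nat).

(** Here [f i] is the multiplicity of the part [i], bounded by [k] through the codomain. The
    constraints are separate for each index, apart from the sum, so that these functions index the
    expansion of a product of polynomials. *)
Definition mults : {set {ffun 'I_n.+1 -> 'I_k.+1}} :=
  [set f : {ffun 'I_n.+1 -> 'I_k.+1} |
    [forall i : 'I_n.+1, ((0 < i) && (val i \in S)) || (f i == ord0)]
      && (\sum_(i < n.+1) f i * i == n)].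

(** [inord] falls back to 0 on counts above [k]; none occur on [restricted]. *)
Let mult_of (t : n.-bseq 'I_n.+1) : {ffun 'I_n.+1 -> 'I_k.+1} :=
  [ffun i => inord (count_mem (val i) (map val t))].

Let restricted : {set n.-bseq 'I_n.+1} :=
  [set t : n.-bseq 'I_n.+1 | let s := map val t in
      [&& is_partition n s, parts_in S s & mult_at_most k s]].

Let mult_ofE t i : t \in restricted ->
  mult_of t i = count_mem (val i) (map val t) :> nat.
Proof.
rewrite inE ffunE => /and3P[_ _ /allP/= t_le].
rewrite inordK // ltnS; case: (boolP (val i \in map val t)) => [/t_le|].
  by [].
by move/count_memPn->.
Qed.

Let bseq_lt (t : n.-bseq 'I_n.+1) : all (ltn^~ n.+1) (map val t).
Proof. by apply/allP => _ /mapP[i _ ->]; apply: ltn_ord. Qed.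

(** A sorted sequence is determined by its multiplicities, and all its entries are at most [n]. *)
Let mult_of_inj : {in restricted &, injective mult_of}.
Proof.
move=> t u tR uR eq_tu; apply/val_inj/(inj_map val_inj).
have [] : is_partition n (map val t) /\ is_partition n (map val u).
  by move: tR uR; rewrite !inE => /and3P[-> _ _] /and3P[-> _ _].
move=> /and3P[t_srt _ _] /and3P[u_srt _ _].
apply: (sorted_eq (leT := geq)) => //.
- by move=> x y z /= h1 h2; apply: leq_trans h2 h1.
- by move=> x y /andP[h1 h2]; apply/anti_leq/andP.
apply/allP => x; rewrite mem_cat => x_in /=.
have x_lt : x < n.+1.
  by case/orP: x_in => /(allP (bseq_lt _)).
by rewrite -(mult_ofE (Ordinal x_lt) tR) eq_tu mult_ofE.
Qed.

Let mult_of_img : mult_of @: restricted = mults.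
Proof.
apply/setP => f; apply/imsetP/idP => [[t tR ->]|].
  rewrite inE; apply/andP; split.
    apply/forallP => i; rewrite -val_eqE /= mult_ofE //.
    case: (boolP (val i \in map val t)) => [i_in|/count_memPn->]; last first.
      by rewrite orbT.
    move: tR; rewrite inE => /and3P[/and3P[_ /allP/(_ _ i_in) /= -> _]].
    by move=> /allP/(_ _ i_in) ->.
  under eq_bigr do rewrite mult_ofE //.
  by rewrite -sumn_count //; move: tR; rewrite inE => /and3P[/and3P[]].
rewrite inE => /andP[/forallP fS /eqP f_sum].
(* The preimage of [f]: [f i] copies of each [i], in decreasing order. *)
pose s := sort geq (flatten [seq nseq (f i) (val i) | i <- enum 'I_n.+1]).
have s_count (i : 'I_n.+1) : count_mem (val i) s = f i.
  rewrite (permP (permEl (perm_sort _ _))) count_flatten -map_comp sumnE big_map.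
  rewrite big_enum (bigD1 i) //= count_nseq /= eqxx mul1n big1 ?addn0 // => j.
  by rewrite count_nseq /= val_eqE => /negbTE->.
have s_in x : x \in s -> exists2 i : 'I_n.+1, x = i & f i != ord0.
  rewrite mem_sort => /flatten_mapP[i _]; rewrite mem_nseq => /andP[fi /eqP->].
  by exists i; rewrite // -val_eqE -lt0n.
have s_part : is_partition n s.
  apply/and3P; split.
  - by apply: sort_sorted => x y; apply: leq_total.
  - apply/allP => _ /s_in[i -> fi].
    by move: (fS i); rewrite (negbTE fi) orbF => /andP[].
  - rewrite (@sumn_count n.+1); last by apply/allP => _ /s_in[i -> _] /=.
    by under eq_bigr do rewrite s_count; rewrite f_sum.
have [t tE] := partition_bseq s_part.
have tR : t \in restricted.
  rewrite inE /= tE s_part /=.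
  apply/andP; split; apply/allP => _ /s_in[i -> fi].
    by move: (fS i); rewrite (negbTE fi) orbF => /andP[].
  by rewrite s_count -ltnS.
exists t => //; apply/ffunP => i; apply: val_inj.
by rewrite /= mult_ofE // tE s_count.
Qed.

Lemma qk_mults : qk k.+1 S n = #|mults|.
Proof.
by rewrite -mult_of_img (card_in_imset mult_of_inj) /qk subn1 cardsE.
Qed.

End Multiplicities.

(** * Generating functions *)

Local Open Scope ring_scope.
Import GRing.Theory.

(** Expanding the product chooses a multiplicity [j] for each part [i]; the choices of total [n] are
    the elements of [mults]. Parts above [n] cannot occur. *)
Lemma coef_gf_qk (R : comNzRingType) k n (S : set nat) : (0 < k)%N ->
  (\prod_(1 <= i < n.+1 | i \in S) \sum_(j < k) 'X^(j * i) : {poly R})`_n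
    = (qk k S n)%:R.
Proof.
case: k => // k _; rewrite qk_mults.
pose Q (i : 'I_n.+1) (j : 'I_k.+1) :=
  ((0 < i)%N && (val i \in S)) || (j == ord0).
(* Index 0 and the indices outside [S] enter with [j] forced to 0, that is, with factor 1. *)
rewrite (_ : \prod_(1 <= i < n.+1 | _) _ =
    \prod_(i : 'I_n.+1) \sum_(j | Q i j) 'X^(j * i) :> {poly R}); last first.
  rewrite -(big_mkord predT (fun i => \sum_(j < k.+1 |
    ((0 < i)%N && (i \in S)) || (j == ord0)) 'X^(j * i))) big_ltn //=.
  rewrite big_pred1_eq muln0 expr0 mul1r big_mkcond.
  apply: eq_big_nat => i /andP[-> _] /=; case: (i \in S) => //=.
  by rewrite big_pred1_eq mul0n expr0.
rewrite bigA_distr_big_dep coef_sum.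
under eq_bigr => f _ do rewrite -expr_sum coefXn.
rewrite -sumr_const big_mkcond [RHS]big_mkcond; apply: eq_bigr => f _.
rewrite [f \in mults _ _ _]inE inE [n == _]eq_sym.
rewrite (_ : [forall x, _] = [forall i : 'I_n.+1, Q i (f i)]) // /Q.
by case: [forall i, _] => //=; case: (_ == n).
Qed.

(** * Reindexing and truncating products *)

Lemma prod_dvd_reindex (R : comNzRingType) (d N : nat) (P : pred nat)
    (F : nat -> R) : (0 < d)%N ->
  \prod_(1 <= m < (d * N).+1 | (d %| m)%N && P m) F m
    = \prod_(1 <= m < N.+1 | P (d * m)%N) F (d * m)%N.
Proof.
move=> d_gt0; rewrite -[RHS](big_map (muln d) P F) -big_filter -[RHS]big_filter.
apply: perm_big; apply: uniq_perm.
- exact/filter_uniq/iota_uniq.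
- apply: filter_uniq; rewrite map_inj_uniq ?iota_uniq // => x y /eqP.
  by rewrite eqn_pmul2l // => /eqP.
move=> m; rewrite !mem_filter [RHS]andbC [LHS]andbAC; congr (_ && _).
rewrite andbC mem_index_iota; apply/idP/mapP => [|[x x_in ->]].
  case/andP=> /andP[m_gt0 m_le] /dvdnP[x def_m]; exists x; last by rewrite mulnC.
  rewrite mem_index_iota; move: m_gt0 m_le.
  by rewrite def_m mulnC !ltnS muln_gt0 d_gt0 leq_pmul2l //= => -> ->.
move: x_in; rewrite mem_index_iota => x_in.
by rewrite !ltnS muln_gt0 d_gt0 leq_pmul2l // dvdn_mulr // andbT.
Qed.

Lemma modp_mul_congr (F : fieldType) (d p p' q q' : {poly F}) :
  p %% d = p' %% d -> q %% d = q' %% d -> (p * q) %% d = (p' * q') %% d.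
Proof.
move=> ep eq; rewrite -modp_mul eq modp_mul [p * _]mulrC [p' * _]mulrC.
by rewrite -modp_mul ep modp_mul.
Qed.

(** Each factor with [m > N] is 1 modulo ['X^(N.+1)]. *)
Lemma prod_modp_trunc (F : fieldType) (N K : nat) (P : pred nat)
    (f : nat -> nat) : (N <= K)%N -> (forall m, (N < m)%N -> (N < f m)%N) ->
  (\prod_(1 <= m < K.+1 | P m) (1 + 'X^(f m)) : {poly F}) %% 'X^(N.+1)
    = (\prod_(1 <= m < N.+1 | P m) (1 + 'X^(f m))) %% 'X^(N.+1).
Proof.
move=> leNK f_gt; rewrite (big_cat_nat (n := N.+1)) //=.
rewrite -[in RHS](mulr1 (\prod_(_ <= _ < _ | _) _)).
apply: modp_mul_congr => //; rewrite big_nat_cond.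
apply: (big_rec (fun p : {poly F} => p %% 'X^(N.+1) = 1 %% 'X^(N.+1))) => // m p.
case/andP=> /andP[/f_gt Nm _] _ p1; rewrite -[in RHS](mulr1 1).
by apply: modp_mul_congr => //; rewrite modpD -(subnKC Nm) exprD modp_mulr addr0.
Qed.

(** * Product identities over the field with two elements *)

Lemma polyF2_addrr (p : {poly 'F_2}) : p + p = 0.
Proof.
rewrite -mulr2n -mulr_natr (_ : 2%:R = 0) ?mulr0 //.
by rewrite -polyC_natr (_ : 2%:R = 0) //; apply: val_inj.
Qed.

Lemma polyF2_opp (p : {poly 'F_2}) : - p = p.
Proof. by apply/eqP; rewrite eq_sym -addr_eq0 polyF2_addrr. Qed.

Lemma polyF2_sqr_prod (s : seq nat) (f : nat -> nat) :
  \prod_(m <- s) (1 + 'X^(2 * f m)) = (\prod_(m <- s) (1 + 'X^(f m))) ^+ 2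
    :> {poly 'F_2}.
Proof.
rewrite -prodrXl; apply: eq_bigr => m _.
by rewrite sqrrD expr1n mul1r mulr2n polyF2_addrr addr0 -exprM mulnC.
Qed.

(* Euler's D(x) = 1 / \prod (1 - x^(2m-1)) modulo 2, with x^d for x. *)
Lemma polyF2_euler (d N : nat) : (0 < d)%N ->
  (\prod_(1 <= m < N.+1) (1 + 'X^(d * m))
    * \prod_(1 <= m < N.+1 | odd m) (1 + 'X^(d * m)) : {poly 'F_2}) %% 'X^(N.+1)
  = 1 %% 'X^(N.+1).
Proof.
move=> d_gt0; set D := \prod_(1 <= m < N.+1) _.
set O := \prod_(1 <= m < N.+1 | _) _.
have d_gt m : (N < m)%N -> (N < d * m)%N.
  by move=> lt_Nm; apply: leq_trans lt_Nm _; rewrite leq_pmull.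
have le_N2N : (N <= 2 * N)%N by rewrite leq_pmull.
(* With the bound [2 * N] the even indices are exactly the doubles of [1..N], so [D ^+ 2] appears
   without truncation. *)
have split_parity : \prod_(1 <= m < (2 * N).+1) (1 + 'X^(d * m))
    = D ^+ 2 * \prod_(1 <= m < (2 * N).+1 | odd m) (1 + 'X^(d * m))
    :> {poly 'F_2}.
  rewrite (bigID (dvdn 2)) /=; congr (_ * _); last first.
    by apply: eq_bigl => m; rewrite dvdn2 negbK.
  rewrite -polyF2_sqr_prod.
  have := @prod_dvd_reindex {poly 'F_2} 2 N predT (fun m => 1 + 'X^(d * m)) isT.
  under eq_bigl do rewrite andbT; move=> ->.
  by apply: eq_bigr => m _; rewrite mulnCA.
have D_sqrO : D %% 'X^(N.+1) = (D ^+ 2 * O) %% 'X^(N.+1).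
  rewrite -(prod_modp_trunc _ predT le_N2N d_gt) split_parity.
  by apply: modp_mul_congr => //; apply: prod_modp_trunc.
apply/eqP; rewrite -subr_eq0 -modpN -modpD; apply/eqP/modp_eq0P.
(* [D] has constant term 1, so it can be cancelled from [D = D ^+ 2 * O] modulo ['X^(N.+1)]. *)
have D_coprime : coprimep 'X^(N.+1) D.
  apply: coprimep_expl; rewrite coprimep_sym coprimepX rootE horner_prod.
  rewrite big_nat_cond big1 ?oner_neq0 // => m /andP[/andP[m_gt0 _] _].
  by rewrite !hornerE expr0n muln_eq0 !gtn_eqF // addr0.
rewrite -(Gauss_dvdpr _ D_coprime) mulrBr mulr1 mulrA.
by apply/modp_eq0P; rewrite modpD modpN -D_sqrO subrr.
Qed.

Lemma coef_modp_Xn (F : fieldType) (p : {poly F}) (n i : nat) :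
  (i < n)%N -> (p %% 'X^n)`_i = p`_i.
Proof.
by move=> lt_in; rewrite [in RHS](divp_eq p 'X^n) coefD coefMXn lt_in add0r.
Qed.

Lemma polyF2_gf_congr (r n : nat) : (0 < r)%N -> odd r ->
  (\prod_(1 <= i < n.+1 | i \in pos_nats) \sum_(j < r) 'X^(j * i)
    : {poly 'F_2}) %% 'X^(n.+1)
  = (\prod_(1 <= i < n.+1 | i \in odd_nats `\` dilate r odd_nats)
       \sum_(j < 2) 'X^(j * i)) %% 'X^(n.+1).
Proof.
move=> r_gt0 r_odd.
set P := (X in X %% _ = _); set Q := (X in _ = X %% _).
pose D d : {poly 'F_2} := \prod_(1 <= m < n.+1) (1 + 'X^(d * m)).
pose O d : {poly 'F_2} := \prod_(1 <= m < n.+1 | odd m) (1 + 'X^(d * m)).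
(* Exact, factor by factor: the geometric sum times [1 + y] is [1 + y ^+ r], signs being irrelevant
   in characteristic 2. *)
have PD : P * D 1%N = D r.
  rewrite /P big_nat_cond (eq_bigl (fun m => (1 <= m < n.+1)%N && true)); last first.
    by move=> m; case: ltnP => //= m_gt0; rewrite mem_set // andbT.
  rewrite -big_nat_cond.
  rewrite -big_split; apply: eq_bigr => m _ /=.
  under eq_bigr do rewrite mulnC exprM.
  have addE (p : {poly 'F_2}) : 1 + p = p - 1 by rewrite polyF2_opp addrC.
  by rewrite mul1n mulrC (mulnC r) exprM !addE -subrX1.
have QO : (Q * O r) %% 'X^(n.+1) = O 1%N %% 'X^(n.+1).
  have r_gt m : (n < m)%N -> (n < r * m)%N.
    by move=> lt_nm; apply: leq_trans lt_nm _; rewrite leq_pmull.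
  (* Since [r] is odd, [O r] runs over the odd multiples of [r] up to [r * n]; those above [n] are
     truncated away, and [Q] supplies the odd non-multiples. *)
  have := @prod_dvd_reindex {poly 'F_2} r n odd (fun m => 1 + 'X^m) r_gt0.
  under [RHS]eq_bigl do rewrite oddM r_odd.
  rewrite -/(O r) => <-.
  rewrite (_ : Q = \prod_(1 <= m < n.+1 | odd m && ~~ (r %| m)%N) (1 + 'X^m)).
    rewrite /O; under [in RHS]eq_bigr do rewrite mul1n.
    rewrite [in RHS](bigID (dvdn r)) /= [in RHS]mulrC.
    apply: modp_mul_congr => //; under [in LHS]eq_bigl do rewrite andbC.
    by apply: (@prod_modp_trunc _ n (r * n) _ id) => //; rewrite leq_pmull.
  apply: eq_big => [m|m _]; last first.
    by rewrite !big_ord_recl big_ord0 /= mul0n mul1n expr0 addr0.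
  (* An odd multiple of [r] has an odd cofactor, so it lies in [dilate r odd_nats]. *)
  apply/idP/idP; rewrite in_setE /odd_nats /dilate /=.
    case=> m_odd m_ndvd; rewrite m_odd /=; apply/negP => /dvdnP[x def_m].
    apply: m_ndvd; exists x; last by rewrite mulnC.
    by move: m_odd; rewrite def_m oddM => /andP[].
  case/andP=> m_odd /negP m_ndvd; split=> // -[x _ def_m].
  by apply: m_ndvd; rewrite -def_m dvdn_mulr.
(* Without inverses: [P = P * D 1 * O 1 = D r * O 1 = D r * (Q * O r) = Q] modulo ['X^(n.+1)], using
   Euler's identity for [d = 1] and [d = r]. *)
rewrite -[P]mulr1 -(modp_mul_congr (erefl (P %% _)) (polyF2_euler n (ltn0Sn 0))).
rewrite mulrA -/(D 1%N) -/(O 1%N) PD -(modp_mul_congr (erefl (D r %% _)) QO).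
by rewrite mulrCA (modp_mul_congr (erefl (Q %% _)) (polyF2_euler n r_gt0)) mulr1.
Qed.

Local Close Scope ring_scope.

Theorem theorem3p6 (r : nat) (r_ge3 : 3 <= r) (r_odd : odd r) (n : nat) :
  qk r pos_nats n = q (odd_nats `\` dilate r odd_nats) n %[mod 2].
Proof.
have r_gt0 : 0 < r by apply: leq_trans r_ge3.
(* A residue modulo 2 is the value of the image in ['F_2], so it suffices to compare coefficients
   there. *)
rewrite -!(@val_Fp_nat 2) //; congr (val _).
rewrite -(coef_gf_qk 'F_2) // -[RHS](coef_gf_qk 'F_2) //.
by rewrite -(coef_modp_Xn _ (ltnSn n)) polyF2_gf_congr // coef_modp_Xn.
Qed.
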